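(* For every $\alpha\in(0,1]$ there is a constant $C(\alpha)>0$, depending only on $\alpha$, such that the following holds. Let $(X,\|\cdot\|)$ be a superreflexive (real) Banach space whose norm satisfies, for some $C>0$, $$\lambda\|x\|^{1+\alpha}+(1-\lambda)\|y\|^{1+\alpha}-\|\lambda x+(1-\lambda)y\|^{1+\alpha}\le C\,\lambda(1-\lambda)\|x-y\|^{1+\alpha}\quad\text{for all }\lambda\in[0,1],\ x,y\in X. \quad ( * )$$ Let $\omega$ be a modulus of continuity such that $t\mapsto t^\alpha/\omega(t)$ is non-decreasing on $(0,\infty)$. Let $\emptyset\neq E\subset X$, and let $f:E\to\mathbb{R}$, $G:E\to X^*$ be arbitrary functions. (i) There exists a convex function $F\in C^{1,\omega}(X)$ with $F=f$ and $DF=G$ on $E$ if and only if there is some $M>0$ such that $$f(y)+G(y)(x-y)+M\varphi_\omega(\|x-y\|)\ge f(z)+G(z)(x-z)\quad\text{for all }y,z\in E,\ x\in X. \quad ( ** )$$ (ii) If $( ** )$ holds with constant $M>0$, then the formula $$F:=\operatorname{conv}(g),\qquad g(x)=\inf_{y\in E}\{f(y)+G(y)(x-y)+M\varphi_\omega(\|x-y\|)\},\quad x\in X,$$ defines such an extension (i.e. $F\in C^{1,\omega}(X)$ is convex and $(F,DF)=(f,G)$ on $E$), and $$A_{\omega,\mathrm{co}}(F,DF,X)\le C(\alpha)\cdot C\cdot M\quad\text{and}\quad \operatorname{Lip}_\omega(DF,X)\le \tfrac43\, C(\alpha)\cdot C\cdot M.$$ (iii) If, in addition to $( ** )$ with constant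 $M>0$, $G$ is bounded and $L:=\sup_{z\in E}\|G(z)\|_*$, then the function $F_L:=\operatorname{conv}_L(g)$, with the same $g$ as in (ii), has the same properties as $F$ (it is convex, belongs to $C^{1,\omega}(X)$, satisfies $(F_L,DF_L)=(f,G)$ on $E$, and satisfies both estimates in (ii) with $F_L$ in place of $F$), and moreover $$\sup_{x\in X}\|DF_L(x)\|_*=\operatorname{Lip}(F_L,X)=L=\sup_{z\in E}\|G(z)\|_*.$$ (iv) If $\omega$ is increasing and $\lim_{t\to\infty}\omega(t)=\infty$, then all statements (i)–(iii) remain valid with $( ** )$ replaced by the following condition (with the same role of the constant $M>0$): $$f(y)\ge f(z)+G(z)(y-z)+M(\varphi_\omega)^*\!\left(\tfrac1M\|G(y)-G(z)\|_*\right)\quad\text{for all }y,z\in E.$$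
   Context: A modulus of continuity is a non-decreasing concave function $\omega:[0,\infty)\to[0,\infty)$ with $\omega(0)=\omega(0^+)=0$ (not identically zero, hence positive on $(0,\infty)$). Put $\varphi_\omega(t)=\int_0^t\omega(s)\,ds$ for $t\ge0$; its Fenchel conjugate is $(\varphi_\omega)^*(t)=\sup_{s\ge0}\{ts-\varphi_\omega(s)\}$ for $t\ge0$. $X^*$ is the dual of $X$ with dual norm $\|\cdot\|_*$. For normed spaces $X,Y$, $E\subset X$ and $H:E\to Y$, $\operatorname{Lip}_\omega(H,E)=\sup_{x\ne z\in E}\frac{\|H(x)-H(z)\|_Y}{\omega(\|x-z\|_X)}$, and $\operatorname{Lip}(H,E)$ is the case $\omega(t)=t$. $C^{1,\omega}(X)$ is the class of functions $F:X\to\mathbb{R}$ that are everywhere Fréchet differentiable with continuous derivative $DF:X\to X^*$ satisfying $\operatorname{Lip}_\omega(DF,X)<\infty$. For $f:E\to\mathbb{R}$, $G:E\to X^*$, $$A_{\omega,\mathrm{co}}(f,G,E)=\sup\left\{\frac{f(z)+G(z)(x-z)-f(y)-G(y)(x-y)}{\varphi_\omega(\|x-y\|)}: y,z\in E,\ x\in X,\ x\neq y\right\}\in[0,+\infty].$$ Suprema over the empty set are $0$ in these definitions. For $g:X\to\mathbb{R}$ with a continuous affine minorant, $\operatorname{conv}(g)(x)=\sup\{h(x): h:X\to\mathbb{R}\text{ convex and continuous},\ h\le g\text{ on }X\}$. For $L\ge0$ and $g$ with an $L$-Lipschitz affine minorant, $\operatorname{conv}_L(g)(x)=\sup\{h(x):h:X\to\mathbb{R}\text{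 convex and }L\text{-Lipschitz},\ h\le g\text{ on }X\}$. *)

(* Defs.v *)
From HB Require Import structures.
From mathcomp Require Import all_boot all_order all_algebra.
From mathcomp Require Import interval_inference.
From mathcomp Require Import all_classical all_reals all_analysis.

Set Implicit Arguments.
Unset Strict Implicit.
Unset Printing Implicit Defensive.

Import Order.TTheory GRing.Theory Num.Theory.
Import numFieldNormedType.Exports.

Local Open Scope classical_set_scope.
Local Open Scope ring_scope.

Definition continuous_functional {R : realType} {X : normedModType R} :
    {pred X -> R^o} :=
  mem [set l : X -> R^o | linear l /\ continuous l].

Record dual {R : realType} (X : normedModType R) : Type := Dual {
  dual_fun :> X -> R^o ;
  dual_funP : dual_fun \in continuous_functional }.

Section dual_normed_module.
Context {R : realType} {X : normedModType R}.
Implicit Types l : dual X.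

HB.instance Definition _ := [isSub for @dual_fun R X].
HB.instance Definition _ := [Choice of dual X by <:].

Lemma continuous_functional_submod_closed :
  GRing.submod_closed (@continuous_functional R X).
Proof.
split.
  rewrite inE; split; last exact: cst_continuous.
  by move=> a x y; rewrite /GRing.zero/= scaler0 addr0.
move=> a u v /[!inE] -[ul uc] [vl vc]; split.
  move=> b x y; have -> z : (a *: u + v) z = a *: u z + v z by [].
  by rewrite ul vl !scalerDr !scalerA addrACA (mulrC a).
move=> x; apply: cvgD; last exact: vc.
by apply: cvgZl_tmp; exact: uc.
Qed.

HB.instance Definition _ := GRing.isSubmodClosed.Build R (X -> R^o)
  continuous_functional continuous_functional_submod_closed.
HB.instance Definition _ := [SubChoice_isSubLmodule of dual X by <:].

Lemma dual_linear l : linear l.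
Proof. by have := dual_funP l; rewrite inE => -[]. Qed.

Lemma dual_continuous l : continuous l.
Proof. by have := dual_funP l; rewrite inE => -[]. Qed.

HB.instance Definition _ l :=
  GRing.isLinear.Build R X R^o *:%R (l : X -> R^o) (dual_linear l).

Definition dual_norm l : R := sup [set `|l x| | x in [set x : X | `|x| <= 1]].

Lemma dual_norm_has_sup l :
  has_sup [set `|l x| | x in [set x : X | `|x| <= 1]].
Proof.
split; first by exists `|l 0|, 0 => //=; rewrite normr0.
have /linear_boundedP[M [_ Ml]] :=
  @continuous_linear_bounded _ _ _ 0 l (@dual_continuous l 0).
exists (Num.max M 0 + 1) => _ [x /= x1 <-].
have M1 : M < Num.max M 0 + 1.
  by rewrite ltr_pwDr// le_max lexx.
apply: (le_trans (Ml _ M1 x)); rewrite ler_piMr//.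
by rewrite addr_ge0// le_max lexx orbT.
Qed.

Lemma dual_norm_ub l (x : X) : `|x| <= 1 -> `|l x| <= dual_norm l.
Proof.
by move=> x1; apply: sup_upper_bound; [exact: dual_norm_has_sup|exists x].
Qed.

Lemma le_dual_norm l (r : R) :
  (forall x, `|x| <= 1 -> `|l x| <= r) -> dual_norm l <= r.
Proof.
move=> lr; apply: ge_sup; first by case: (dual_norm_has_sup l).
by move=> _ [x /= x1 <-]; exact: lr.
Qed.

Lemma dual_norm_ge0 l : 0 <= dual_norm l.
Proof. by apply: le_trans (@dual_norm_ub l 0 _); rewrite ?normr0. Qed.

Lemma dual_normP l x : `|l x| <= dual_norm l * `|x|.
Proof.
have [->|x0] := eqVneq x 0; first by rewrite linear0 !normr0 mulr0.
rewrite -ler_pdivrMr ?normr_gt0//.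
have -> : `|l x| / `|x| = `|l (`|x|^-1 *: x)|.
  by rewrite linearZ normrZ normfV normr_id mulrC.
apply: dual_norm_ub.
by rewrite normrZ normfV normr_id mulVf// normr_eq0.
Qed.

Let dual_ler_normD l1 l2 :
  dual_norm (l1 + l2) <= dual_norm l1 + dual_norm l2.
Proof.
apply: le_dual_norm => x x1; apply: (le_trans (ler_normD (l1 x) (l2 x))).
by apply: lerD; exact: dual_norm_ub.
Qed.

Let dual_normrZ_le (a : R) l : dual_norm (a *: l) <= `|a| * dual_norm l.
Proof.
apply: le_dual_norm => x x1; have -> : (a *: l) x = a * l x by [].
by rewrite normrM ler_wpM2l// dual_norm_ub.
Qed.

Let dual_normrZ (a : R) l : dual_norm (a *: l) = `|a| * dual_norm l.
Proof.
apply/eqP; rewrite eq_le dual_normrZ_le/=.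
have [->|a0] := eqVneq a 0; first by rewrite normr0 mul0r dual_norm_ge0.
rewrite -ler_pdivlMl ?normr_gt0// -normfV.
by apply: le_trans (dual_normrZ_le _ _); rewrite scalerA mulVf// scale1r.
Qed.

Let dual_normr0_eq0 l : dual_norm l = 0 -> l = 0.
Proof.
move=> l0; apply/val_inj/funext => x /=; apply/eqP; rewrite -normr_le0.
by apply: le_trans (dual_normP l x) _; rewrite l0 mul0r.
Qed.

HB.instance Definition _ := Lmodule_isNormed.Build R (dual X)
  dual_ler_normD dual_normrZ dual_normr0_eq0.

End dual_normed_module.

Section superreflexivity.
Context {R : realType}.

Definition reflexive_space (Y : normedModType R) : Prop :=
  forall Phi : dual (dual Y), exists y : Y, forall l : dual Y, Phi l = l y.

(* A finite-dimensional subspace of Y is given by a finite spanning family e,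
   and a linear map from it to X by the images u of the members of e; the upper
   estimate makes sum_i a_i e_i |-> sum_i a_i u_i well defined also when e is
   not free. *)
Definition finitely_representable (Y X : normedModType R) : Prop :=
  forall (n : nat) (e : 'I_n -> Y) (eps : R), 0 < eps ->
  exists u : 'I_n -> X, forall a : 'I_n -> R,
    (1 - eps) * `|\sum_(i < n) a i *: e i| <= `|\sum_(i < n) a i *: u i| /\
    `|\sum_(i < n) a i *: u i| <= (1 + eps) * `|\sum_(i < n) a i *: e i|.

Definition superreflexive (X : completeNormedModType R) : Prop :=
  forall Y : completeNormedModType R,
    finitely_representable Y X -> reflexive_space Y.

Definition norm_power_smooth (X : normedModType R) (alpha C : R) : Prop :=
  forall (lambda : R) (x y : X), 0 <= lambda <= 1 ->
    lambda * `|x| `^ (1 + alpha) + (1 - lambda) * `|y| `^ (1 + alpha)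
      - `|lambda *: x + (1 - lambda) *: y| `^ (1 + alpha)
    <= C * lambda * (1 - lambda) * `|x - y| `^ (1 + alpha).

End superreflexivity.

Section modulus.
Context {R : realType}.
Implicit Types omega phi : R -> R.

(* Functions on [0, +oo[ are represented by functions on R whose values at
   negative arguments are irrelevant. *)
Record modulus_of_continuity omega : Prop := ModulusOfContinuity {
  modulus_ge0 : forall t, 0 <= t -> 0 <= omega t ;
  modulus_nondecreasing : forall s t, 0 <= s -> s <= t -> omega s <= omega t ;
  modulus_concave :
    convex_function (E := R^o) `[0, +oo[%classic (fun t => - omega t) ;
  modulus0 : omega 0 = 0 ;
  modulus_right0 : omega t @[t --> 0^'+] --> 0 ;
  modulus_nontrivial : exists2 t, 0 <= t & omega t != 0 }.

Definition modulus_primitive omega (t : R) : R :=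
  \int[lebesgue_measure]_(s in `[0, t]) omega s.

Definition fenchel_conjugate phi (t : R) : \bar R :=
  ereal_sup [set (t * s - phi s)%:E | s in [set s : R | 0 <= s]].

End modulus.

Section extension_notions.
Context {R : realType} {X : normedModType R}.
Implicit Types (omega : R -> R) (E : set X) (f F g : X -> R) (G : X -> dual X).

(* [supremum 0] is the supremum with value 0 on the empty set. *)
Definition Lip_modulus {Y : normedModType R} omega (H : X -> Y) E : \bar R :=
  supremum 0%E [set q | exists x z, [/\ E x, E z, x != z &
    q = (`|H x - H z| / omega `|x - z|)%:E]].

Definition A_co omega f G E : \bar R :=
  supremum 0%E [set q | exists y z x, [/\ E y, E z, x != y &
    q = ((f z + G z (x - z) - f y - G y (x - y))
         / modulus_primitive omega `|x - y|)%:E]].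

(* The Frechet derivative as an element of the dual; the default value 0 of
   [insubd] is only taken where F is not differentiable. *)
Definition frechet F (x : X) : dual X :=
  insubd (0 : dual X) ('d F x : X -> R^o).

Lemma frechetE F (x : X) : differentiable F x ->
  frechet F x = 'd F x :> (X -> R).
Proof.
move=> dF; rewrite /frechet insubdK// inE; split; first exact: linearP.
exact: diff_continuous.
Qed.

Definition C1_modulus omega F : Prop :=
  [/\ forall x, differentiable F x, continuous (frechet F) &
      (Lip_modulus omega (frechet F) setT < +oo)%E].

Definition convex_on_space F : Prop := convex_function (E := X) setT F.

Definition convex_envelope g (x : X) : R :=
  sup [set h x | h in [set h : X -> R |
    [/\ convex_on_space h, continuous h & forall y, h y <= g y]]].

Definition convex_envelope_Lip (L : R) g (x : X) : R :=
  sup [set h x | h in [set h : X -> R |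
    [/\ convex_on_space h, L.-lipschitz h & forall y, h y <= g y]]].

(* f and G stand for functions on E: their values off E are never used. *)
Definition inf_envelope omega E f G (M : R) (x : X) : R :=
  inf [set f y + G y (x - y) + M * modulus_primitive omega `|x - y| | y in E].

Definition jet_condition omega E f G (M : R) : Prop :=
  forall y z x, E y -> E z ->
    f y + G y (x - y) + M * modulus_primitive omega `|x - y|
    >= f z + G z (x - z).

Definition jet_conjugate_condition omega E f G (M : R) : Prop :=
  forall y z, E y -> E z ->
    ((f y)%:E >= (f z + G z (y - z))%:E
      + M%:E * fenchel_conjugate (modulus_primitive omega)
                 (M^-1 * `|G y - G z|)%R)%E.

Definition C1_convex_extension omega E f G F : Prop :=
  [/\ convex_on_space F, C1_modulus omega F &
      forall y, E y -> F y = f y /\ frechet F y = G y].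

End extension_notions.

(* Main.v *)
(* With C(alpha) = 16; write phi for the primitive of omega. Since
   omega t / t^alpha is non-increasing, phi is a concave function of
   t^(1 + alpha), so the smoothness of the norm expressed by the hypothesis on
   C passes to phi o |.| :
     phi |x + h| + phi |x - h| - 2 phi |x| <= 16 C phi |h|.
   This upper bound on second differences survives sums with affine functions,
   infima, and convex envelopes: if u and v are minorants of g, then so is
   x |-> (u (x + h) + v (x - h) - c) / 2 for the appropriate constant c. A convex
   function F, bounded above on balls, with such a bound has one-sided
   directional derivatives that are linear, because phi t = o(t); hence F is
   differentiable, and F (x + h) - F x - DF x h <= 16 C M phi |h|. Comparing two
   such expansions controls the modulus of DF. On E the envelope is squeezed
   between the affine minorants f z + G z (x - z) and g, which gives F = f and
   DF = G there. *)
From HB Require Import structures.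
Require Import Defs.
From mathcomp Require Import all_boot all_order all_algebra.
From mathcomp Require Import interval_inference ring lra.
From mathcomp Require Import all_classical all_reals all_analysis.
From mathcomp Require Import measurable_realfun.

Set Implicit Arguments.
Unset Strict Implicit.
Unset Printing Implicit Defensive.

Import Order.TTheory GRing.Theory Num.Theory.
Import numFieldNormedType.Exports.

Local Open Scope classical_set_scope.
Local Open Scope ring_scope.

(** * Moduli of continuity and their primitives *)

Lemma ger0_is_derive_le (R : realType) (f df : R -> R) (a b : R) : a <= b ->
  (forall x, a <= x <= b -> is_derive x 1 f (df x)) ->
  (forall x, a <= x <= b -> 0 <= df x) -> f a <= f b.
Proof.
move=> ab fdf df0.
have ioo x : x \in `]a, b[ -> a <= x <= b.
  by rewrite in_itv/= => /andP[/ltW -> /ltW ->].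
apply: (@ger0_derive1_le_cc _ f a b) => //; last 2 first.
- by rewrite in_itv/= lexx.
- by rewrite in_itv/= lexx ab.
- by move=> x /ioo /fdf [].
- by move=> x /ioo xab; rewrite derive1E; have [_ ->] := fdf _ xab; exact: df0.
- apply: derivable_within_continuous => x; rewrite in_itv/= => /fdf[]//.
Qed.

Section modulus_theory.
Context {R : realType}.
Variables (omega : R -> R) (modw : modulus_of_continuity omega).
Notation phi := (modulus_primitive omega).

Let w_ge0 := modulus_ge0 modw.
Let w_nd := modulus_nondecreasing modw.

Lemma modulus_concave_ineq (l s t : R) : 0 <= l -> l <= 1 -> 0 <= s -> 0 <= t ->
  l * omega s + (1 - l) * omega t <= omega (l * s + (1 - l) * t).
Proof.
move=> l0 l1 s0 t0; have := @modulus_concave _ _ modw (Itv01 l0 l1) s t.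
rewrite !inE/= !in_itv/= !andbT => /(_ s0 t0).
by rewrite lerNl; congr (_ <= _); rewrite convRE/= !mulrN -opprD opprK.
Qed.

(** Concavity on the chord from [0] to [t], with [omega 0 = 0]: the quotient [omega t / t] is
    non-increasing. The form without division also covers [s = 0]. *)
Lemma modulus_scale (s t : R) : 0 <= s -> s <= t -> s * omega t <= t * omega s.
Proof.
move=> s0 st; have [t0|t0] := ltP 0 t; last first.
  have -> : t = s by apply/eqP; rewrite eq_le st andbT (le_trans t0).
  by [].
have := @modulus_concave_ineq (s / t) t 0 _ _ (ltW t0) (lexx _).
rewrite (modulus0 modw) !mulr0 !addr0 divfK ?gt_eqF//.
rewrite -mulrA mulrCA ler_pdivrMl//.
rewrite divr_ge0 ?(ltW t0)// ler_pdivrMr// mul1r => h; exact: h.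
Qed.

(** Positivity at one point spreads to the right by monotonicity and to the left by
    [modulus_scale]. *)
Lemma modulus_gt0 (t : R) : 0 < t -> 0 < omega t.
Proof.
move=> t0; have [u u0 wu] := modulus_nontrivial modw.
have {}wu : 0 < omega u by rewrite lt_neqAle eq_sym wu w_ge0.
have [ut|tu] := leP u t; first exact/(lt_le_trans wu)/w_nd.
have := modulus_scale (ltW t0) (ltW tu).
move=> /(lt_le_trans (mulr_gt0 t0 wu)).
by rewrite pmulr_rgt0// (lt_trans t0).
Qed.

Lemma modulus_measurable (D : set R) : measurable D -> D `<=` `[0, +oo[ ->
  measurable_fun D omega.
Proof.
move=> mD D0.
(* Monotonicity is known only on the half-line, so [omega] is extended by its value at [0] before
   measurability of monotone functions is applied. *)
have h : {in D, (fun t => omega (Num.max 0 t)) =1 omega}.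
  move=> t; rewrite inE => /D0; rewrite /= in_itv/= andbT => t0.
  by rewrite (max_idPr t0).
apply: (eq_measurable_fun _ h); apply: nondecreasing_measurable => // s t st; apply: w_nd.
  by rewrite le_max lexx.
by rewrite ge_max !le_max lexx/= st orbT.
Qed.

Lemma modulus_integrable (a b : R) : 0 <= a ->
  (@lebesgue_measure R).-integrable `[a, b] (EFin \o omega).
Proof.
move=> a0; apply: measurable_bounded_integrable => //.
- rewrite /= lebesgue_measure_itv/=; case: ifP => // _; exact: ltry.
- apply: modulus_measurable => // t; rewrite /= !in_itv/= andbT => /andP[at_ _].
  exact: le_trans at_.
- exists (omega b); split; first exact: num_real.
  move=> M bM t; rewrite /= in_itv/= => /andP[at_ tb].
  have t0 := le_trans a0 at_.
  rewrite ger0_norm ?w_ge0//; apply: le_trans (ltW bM).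
  exact: w_nd.
Qed.

(** On []a, b]] the integrand lies between the constants [omega a] and [omega b]. Later estimates of
    [phi] rest on this bound instead of on integrals. *)
Lemma primitive_increment (a b : R) : 0 <= a -> a <= b ->
  (b - a) * omega a <= phi b - phi a <= (b - a) * omega b.
Proof.
move=> a0 ab; rewrite /modulus_primitive.
have iab : lebesgue_measure.-integrable `]a, b] (EFin \o omega).
  apply: (integrableS _ _ _ (modulus_integrable b a0)) => //.
  by apply: subset_itvr; rewrite bnd_simp.
rewrite Rintegral_itvB; last 3 first.
- exact: modulus_integrable.
- by rewrite bnd_simp.
- by rewrite bnd_simp.
have cE r : \int[lebesgue_measure]_(x in `]a, b]) r = (b - a) * r.
  rewrite Rintegral_cst// mulrC; congr (_ * _).
  rewrite /= lebesgue_measure_itv/= lte_fin.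
  move: ab; rewrite le_eqVlt => /predU1P[->|->//].
  by rewrite ltxx subrr.
have ic (r : R) : lebesgue_measure.-integrable `]a, b] (EFin \o cst r).
  apply: measurable_bounded_integrable => //.
    by rewrite /= lebesgue_measure_itv/=; case: ifP => // _; exact: ltry.
  exact: bounded_cst.
apply/andP; split; rewrite -cE; apply: le_Rintegral => //.
- exact: ic.
- by move=> x /=; rewrite in_itv/= => /andP[/ltW ax _]; exact: w_nd.
- exact: ic.
- move=> x /=; rewrite in_itv/= => /andP[/ltW ax xb]; apply: w_nd => //.
  exact: le_trans ax.
Qed.

Lemma primitive0 : phi 0 = 0.
Proof. by rewrite /modulus_primitive set_itv1 Rintegral_set1. Qed.

Lemma primitive_le (t : R) : 0 <= t -> phi t <= t * omega t.
Proof.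
by move=> t0; have /andP[_] := primitive_increment (lexx 0) t0;
  rewrite primitive0 !subr0.
Qed.

Lemma primitive_nd (s t : R) : 0 <= s -> s <= t -> phi s <= phi t.
Proof.
move=> s0 st; rewrite -subr_ge0.
have /andP[+ _] := primitive_increment s0 st; apply: le_trans.
by rewrite mulr_ge0 ?subr_ge0// w_ge0.
Qed.

Lemma primitive_ge0 (t : R) : 0 <= t -> 0 <= phi t.
Proof. by move=> t0; rewrite -primitive0 primitive_nd. Qed.

(** The increment over [[t / 2, t]] is at least [t / 2 * omega (t / 2)], and [omega (t / 2)] is at
    least [omega t / 2]. *)
Lemma primitive_ge (t : R) : 0 <= t -> t * omega t <= 4 * phi t.
Proof.
move=> t0; have h0 : 0 <= t / 2 by rewrite divr_ge0.
have ht : t / 2 <= t by lra.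
have /andP[+ _] := primitive_increment h0 ht.
have := primitive_ge0 h0; have := modulus_scale h0 ht; nra.
Qed.

Lemma primitive_gt0 (t : R) : 0 < t -> 0 < phi t.
Proof.
move=> t0; have := mulr_gt0 t0 (modulus_gt0 t0).
by have := primitive_ge (ltW t0); lra.
Qed.

Lemma modulus_continuous (t : R) : 0 < t -> {for t, continuous omega}.
Proof.
move=> t0; apply/cvgrPdist_le => /= e e0.
have wt0 := modulus_gt0 t0.
near=> u.
have d : `|t - u| <= t / 2.
  near: u; apply/nbhs_normP; exists (t / 2) => /=; first by rewrite divr_gt0.
  by move=> z /= /ltW.
have d' : `|t - u| <= e * t / (2 * omega t).
  near: u; apply/nbhs_normP; exists (e * t / (2 * omega t)) => /=.
    by rewrite !(divr_gt0, mulr_gt0).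
  by move=> z /= /ltW.
(* A local Lipschitz estimate, obtained from [modulus_scale] on either side of [t]. *)
suff h : `|omega t - omega u| * t <= `|t - u| * (2 * omega t).
  rewrite -(ler_pM2r t0); apply: (le_trans h).
  by rewrite -ler_pdivlMr// mulr_gt0.
have u0 : 0 <= u by have := ler_norm (t - u); lra.
have [tu|/ltW ut] := leP t u.
  rewrite !ler0_norm ?subr_le0 ?w_nd ?(ltW t0)//.
  have := modulus_scale (ltW t0) tu; nra.
rewrite !ger0_norm ?subr_ge0 ?w_nd ?(ltW t0)//.
have u2 : t / 2 <= u by have := ler_norm (t - u); lra.
have := modulus_scale u0 ut; have := w_nd u0 ut; nra.
Unshelve. all: by end_near. Qed.

(** By [primitive_increment] the difference quotient lies between [omega t] and [omega (h + t)];
    continuity of [omega] at [t] concludes. *)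
Lemma is_derive_primitive (t : R) : 0 < t -> is_derive t 1 phi (omega t).
Proof.
move=> t0.
suff h : (fun h => h^-1 *: ((phi \o shift t) (h *: (1 : R)) - phi t)) @ 0^' -->
    omega t.
  by split; [apply/cvg_ex; exists (omega t)|exact: cvg_lim].
apply/cvgrPdist_le => /= e e0.
have /cvgrPdist_le/(_ e e0) := modulus_continuous t0.
move=> /nbhs_normP[r /= r0 H].
rewrite /dnbhs near_withinE; near=> h => h0.
have th : 0 <= h + t.
  near: h; apply/nbhs_normP; exists t => //= z /=; rewrite sub0r normrN => zt.
  by have := ler_norm (- z); rewrite normrN; lra.
have {}H : `|omega t - omega (h + t)| <= e.
  apply: H; near: h; apply/nbhs_normP; exists r => //= z /=.
  by rewrite sub0r (_ : t - (z + t) = - z)//; ring.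
apply: le_trans H; rewrite /GRing.scale/= mulr1.
have [hp|hn] := ltP 0 h.
  have /andP[] : h * omega t <= phi (h + t) - phi t <= h * omega (h + t).
    have := @primitive_increment t (h + t) (ltW t0).
    by rewrite addrK; apply; rewrite lerDr ltW.
  rewrite -!(ler_pdivlMl _ _ hp) -!(ler_pdivrMl _ _ hp) => l u.
  rewrite distrC (distrC (omega t)) !ger0_norm ?lerD2r ?subr_ge0//.
  exact: le_trans u.
have {hn h0} hp : 0 < - h by rewrite oppr_gt0 lt_neqAle h0.
have /andP[] : - h * omega (h + t) <= phi t - phi (h + t) <= - h * omega t.
  have := @primitive_increment (h + t) t th.
  rewrite (_ : t - (h + t) = - h); last by ring.
  by apply; lra.
rewrite -!(ler_pdivlMl _ _ hp) -!(ler_pdivrMl _ _ hp) invrN mulNr -mulrN opprB => l u.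
rewrite !ger0_norm ?lerD2l ?lerN2 ?subr_ge0//.
exact: le_trans u.
Unshelve. all: by end_near. Qed.

(* The derivative of [u |-> phi (d + u) - phi (d - u)] is
   [omega (d + u) + omega (d - u) <= 2 * omega d]. *)
Lemma primitive_double (d : R) : 0 < d -> phi (2 * d) <= 2 * d * omega d.
Proof.
move=> d0.
(* The derivative of [phi] is available only at positive arguments, so [u] stops at [d - e]. The two
   end pieces, [phi e] and the increment over [[2 * d - e, 2 * d]], each cost at most
   [e * omega (2 * d)]. *)
suff H e : 0 < e -> e < d -> phi (2 * d) <= 2 * d * omega d + e * (2 * omega (2 * d)).
  apply/ler_addgt0Pr => e e0; pose k := 2 * omega (2 * d).
  have k0 : 0 < k by rewrite mulr_gt0// modulus_gt0// mulr_gt0.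
  have m0 : 0 < Num.min (e / k) (d / 2) by rewrite lt_min !divr_gt0.
  apply: (le_trans (H _ m0 _)); last first.
    by rewrite lerD2l -/k -ler_pdivlMr// ge_min lexx.
  by rewrite gt_min; apply/orP; right; lra.
move=> e0 ed.
pose D u := 2 * u * omega d - (phi (d + u) - phi (d - u)).
have : D 0 <= D (d - e).
  apply: (@ger0_is_derive_le _ _
    (fun u => 2 * omega d - (omega (d + u) + omega (d - u)))).
  - by rewrite subr_ge0 ltW.
  - move=> u /andP[u0 ude].
    have p1 : 0 < d + u by lra.
    have p2 : 0 < d - u by lra.
    have d1 : is_derive u 1 (phi \o (fun u => d + u)) (omega (d + u) * 1).
      apply: is_derive1_comp; first exact: is_derive_primitive.
      apply: (is_derive_eq (is_deriveD (is_derive_cst d u 1) (is_derive_id u 1))).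
      by rewrite add0r.
    have d2 : is_derive u 1 (phi \o (fun u => d - u)) (omega (d - u) * - 1).
      apply: is_derive1_comp; first exact: is_derive_primitive.
      apply: (is_derive_eq (is_deriveB (is_derive_cst d u 1) (is_derive_id u 1))).
      by rewrite sub0r.
    have d3 := is_deriveZ (2 * omega d) (is_derive_id u 1).
    have -> : D = (2 * omega d) \*: id -
        ((phi \o (fun u => d + u)) - (phi \o (fun u => d - u))).
      by apply/funext => v; rewrite /D mulrAC.
    apply: (is_derive_eq (is_deriveB d3 (is_deriveB d1 d2))).
    by rewrite /GRing.scale/=; ring.
  - move=> u /andP[u0 ude].
    have := @modulus_concave_ineq 2^-1 (d + u) (d - u).
    rewrite (_ : 2^-1 * (d + u) + (1 - 2^-1) * (d - u) = d); last by field.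
    lra.
rewrite /D.
have -> : d + (d - e) = 2 * d - e by ring.
have -> : d - (d - e) = e by ring.
rewrite addr0 subr0 mulr0 mul0r !subrr.
have := @primitive_increment (2 * d - e) (2 * d).
have := primitive_le (ltW e0).
have /(_ (ltW e0)) := @w_nd e (2 * d).
have := w_ge0 (ltW d0).
nra.
Qed.

End modulus_theory.

(** * Smoothness of the primitive composed with the norm *)

Section norm_smoothness.
Context {R : realType}.
Variables (omega : R -> R) (modw : modulus_of_continuity omega).
Variables (alpha : R) (alpha0 : 0 < alpha) (alpha1 : alpha <= 1).
Hypothesis powR_over_modulus : forall s t : R, 0 < s -> s <= t ->
  s `^ alpha / omega s <= t `^ alpha / omega t.
Notation phi := (modulus_primitive omega).

Lemma modulus_over_powR (s t : R) : 0 < s -> s <= t ->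
  omega t <= omega s / s `^ alpha * t `^ alpha.
Proof.
move=> s0 st; have t0 := lt_le_trans s0 st.
have := powR_over_modulus s0 st.
have ws := modulus_gt0 modw s0; have wt := modulus_gt0 modw t0.
have ps : 0 < s `^ alpha by rewrite powR_gt0.
rewrite ler_pdivrMr// mulrAC ler_pdivlMr// => h.
by rewrite mulrAC ler_pdivlMr// mulrC (mulrC (omega s)).
Qed.

(* [phi] is a concave function of [t `^ (1 + alpha)], because
   [omega t / t `^ alpha] is non-increasing. *)
Lemma primitive_tangent (a r : R) : 0 <= a -> 0 < r ->
  phi a - phi r <=
  omega r / r `^ alpha / (1 + alpha) * (a `^ (1 + alpha) - r `^ (1 + alpha)).
Proof.
move=> a0 r0; set c := omega r / r `^ alpha.
have a1 : 0 < 1 + alpha by rewrite addr_gt0.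
have c0 : 0 < c by rewrite divr_gt0 ?powR_gt0 ?modulus_gt0.
have cP t : 0 < t -> (r <= t -> omega t <= c * t `^ alpha) /\
    (t <= r -> c * t `^ alpha <= omega t).
  move=> t0; split=> [|tr]; first exact: modulus_over_powR.
  rewrite /c mulrAC ler_pdivrMr ?powR_gt0//.
  by have := modulus_over_powR t0 tr; rewrite mulrAC ler_pdivlMr ?powR_gt0.
clearbody c.
(* The derivative of [D] is non-positive to the left of [r] and non-negative to the right, so [D] is
   minimal at [r]. *)
pose D t := c / (1 + alpha) * t `^ (1 + alpha) - phi t.
have dD (t : R) : 0 < t -> is_derive t 1 D (c * t `^ alpha - omega t).
  move=> t0.
  have d1 := is_deriveZ (c / (1 + alpha)) (is_derive1_powR (1 + alpha) t0).
  apply: (is_derive_eq (is_deriveB d1 (is_derive_primitive modw t0))).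
  by rewrite addrAC subrr add0r /GRing.scale/= mulrA divfK ?gt_eqF.
suff : D r <= D a.
  rewrite /D mulrBr; move: (_ * _ `^ _) (_ * _ `^ _) (phi a) (phi r) => *; lra.
have pos (b : R) : 0 < b -> D r <= D b.
  move=> b0; have [rb|/ltW br] := leP r b.
    apply: (@ger0_is_derive_le _ D (fun t => c * t `^ alpha - omega t) _ _ rb) => x /andP[rx xb].
      by apply: dD; exact: lt_le_trans rx.
    by rewrite subr_ge0 (cP _ _).1//; exact: (lt_le_trans r0).
  suff : (- D) b <= (- D) r by rewrite /GRing.opp/= lerN2.
  apply: (@ger0_is_derive_le _ (- D) (fun t => - (c * t `^ alpha - omega t)) _ _ br) => x /andP[bx xr].
    by apply: is_deriveN; apply: dD; exact: lt_le_trans bx.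
  by rewrite opprB subr_ge0 (cP _ _).2//; exact: (lt_le_trans b0).
move: a0; rewrite le_eqVlt => /predU1P[<-|]; last exact: pos.
(* The endpoint [a = 0] is reached as a limit: [D r <= D b <= e] for small [b > 0]. *)
apply/ler_addgt0Pr => e e0; rewrite {2}/D primitive0 powR0 ?gt_eqF// mulr0 subrr add0r.
have /cvgrPdist_le/(_ (e * ((1 + alpha) / c))) := @powR_cvg0 R _ a1.
rewrite pmulr_rgt0// divr_gt0// => /(_ isT) H.
have [b [b0 hb]] : exists b : R, 0 < b /\ b `^ (1 + alpha) <= e * ((1 + alpha) / c).
  near (0 : R)^'+ => b; exists b; split=> //.
  suff : `|0 - b `^ (1 + alpha)| <= e * ((1 + alpha) / c).
    by rewrite sub0r normrN ger0_norm ?powR_ge0.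
  by near: b.
apply: (le_trans (pos _ b0)); rewrite /D.
have := primitive_ge0 modw (ltW b0).
suff : c / (1 + alpha) * b `^ (1 + alpha) <= e by lra.
by rewrite mulrC -ler_pdivlMr ?divr_gt0// invf_div.
Unshelve. all: by end_near. Qed.

Variables (X : normedModType R) (C : R) (C0 : 0 < C).
Hypothesis smoothX : norm_power_smooth X alpha C.

(** The smoothness hypothesis at the midpoint of [x + h] and [x - h], whose difference is [2 *: h];
    the constant uses [2 ^ (1 + alpha) <= 4]. *)
Lemma norm_power_second_difference (x h : X) :
  `|x + h| `^ (1 + alpha) + `|x - h| `^ (1 + alpha) - 2 * `|x| `^ (1 + alpha)
  <= 2 * C * `|h| `^ (1 + alpha).
Proof.
have := @smoothX 2^-1 (x + h) (x - h).
have -> : 2^-1 *: (x + h) + (1 - 2^-1) *: (x - h) = x.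
  have -> : 1 - 2^-1 = 2^-1 :> R by field.
  rewrite -scalerDr addrACA subrr addr0 -[x in x + x]scale1r -scalerDl scalerA.
  by rewrite (_ : _ * _ = 1) ?scale1r//; field.
have -> : x + h - (x - h) = 2 *: h.
  by rewrite opprB addrA addrC addrA addrA addNr add0r scaler_nat mulr2n.
rewrite normrZ powRM// ger0_norm// invr_ge0 ler0n/= invf_le1//.
have : 2 `^ (1 + alpha) <= 4 :> R.
  have -> : 4 = 2 `^ 2%:R :> R by rewrite powR_mulrn// -natrX.
  have h12 : 1 <= 2 :> R by lra.
  by apply: (ler_powR h12); rewrite (_ : 2 = 1 + 1)// lerD2l.
have := powR_ge0 `|h| (1 + alpha).
move: (`|h| `^ (1 + alpha)) (2 `^ (1 + alpha)) => H T H0 T4 /(_ _).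
have CHT : C * H * T <= C * H * 4 by rewrite ler_wpM2l// mulr_ge0// ltW.
have h12 : 1 <= 2 :> R by lra.
move=> /(_ h12); move: (_ `^ _) (_ `^ _) (_ `^ _) => p q r; lra.
Qed.

(** The second difference at [x = 0] is [2 * |h| ^ (1 + alpha)]. The bound lets a numerical constant
    be absorbed into a multiple of [C]. *)
Lemma norm_power_smooth_ge1 (h : X) : h != 0 -> 1 <= C.
Proof.
move=> h0; have := norm_power_second_difference 0 h.
have p0 : 0 < `|h| `^ (1 + alpha) by rewrite powR_gt0// normr_gt0.
rewrite add0r sub0r normrN normr0 powR0 ?mulr0 ?subr0; last by rewrite gt_eqF// addr_gt0.
by rewrite -(ler_pM2r p0); move: (_ `^ _) => P; lra.
Qed.

Lemma primitive_norm_second_difference (x h : X) :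
  phi `|x + h| + phi `|x - h| - 2 * phi `|x| <= 16 * C * phi `|h|.
Proof.
have [->|h0] := eqVneq h 0.
  by rewrite addr0 subr0 normr0 primitive0 mulr0; lra.
have C1 := norm_power_smooth_ge1 h0.
have s0 : 0 < `|h| by rewrite normr_gt0.
have ph := primitive_gt0 modw s0.
have wh := primitive_ge modw (ltW s0).
(* For [|x| < |h|] both norms are at most [2 * |h|], and [phi (2 * |h|) <= 2 * |h| * omega |h| <= 8
   * phi |h|]; this is the origin of [16]. For [|h| <= |x|] the tangent bound at [|x|] reduces the
   claim to powers of the norm. *)
have [sr|rs] := leP `|h| `|x|; last first.
  have d2 := primitive_double modw s0.
  have xp : phi `|x + h| <= phi (2 * `|h|).
    by apply: primitive_nd => //; have := ler_normD x h; lra.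
  have xm : phi `|x - h| <= phi (2 * `|h|).
    by apply: primitive_nd => //; have := ler_normB x h; lra.
  have px := primitive_ge0 modw (normr_ge0 x).
  have : 16 * phi `|h| <= 16 * C * phi `|h| by rewrite ler_pM2r// ler_peMr.
  lra.
have r0 := lt_le_trans s0 sr.
have t1 := primitive_tangent (normr_ge0 (x + h)) r0.
have t2 := primitive_tangent (normr_ge0 (x - h)) r0.
set c := omega _ / _ / _ in t1 t2.
have c0 : 0 <= c.
  apply: divr_ge0; last by rewrite ltW// addr_gt0.
  by apply: divr_ge0; [exact: (modulus_ge0 modw)|exact: powR_ge0].
have n2 := norm_power_second_difference x h.
(* Since [|h| <= |x|], the ratio [omega r / r ^ alpha] at [r = |x|] is at most its value at
   [|h|]. *)
have cs : c * `|h| `^ (1 + alpha) <= `|h| * omega `|h|.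
  rewrite /c powRD; last by rewrite (gt_eqF s0) implybT.
  have wr := modulus_over_powR s0 sr.
  rewrite powRr1// mulrCA ler_pM2l// mulrAC ler_pdivrMr; last by rewrite addr_gt0.
  rewrite mulrAC ler_pdivrMr ?powR_gt0//.
  move: wr; rewrite mulrAC ler_pdivlMr ?powR_gt0// => /le_trans; apply.
  rewrite -mulrA ler_wpM2l ?(modulus_ge0 modw)//.
  by rewrite ler_peMl ?powR_ge0// lerDl ltW.
have : c * (2 * C * `|h| `^ (1 + alpha)) <= 2 * C * (`|h| * omega `|h|).
  by rewrite mulrCA ler_wpM2l// mulr_ge0// ltW.
have := ler_wpM2l c0 n2.
have : 2 * C * (`|h| * omega `|h|) <= 2 * C * (4 * phi `|h|).
  by rewrite ler_wpM2l// mulr_ge0// ltW.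
have := mulr_gt0 C0 ph.
lra.
Qed.

End norm_smoothness.

(** * Differentiability of convex functions with small second differences *)

Section convex_first_order.
Context {R : realType} {X : normedModType R}.
Implicit Types (F : X -> R) (x h : X).

Lemma convex_on_spaceP F : convex_on_space F <->
  forall (l : R) (x y : X), 0 <= l -> l <= 1 ->
    F (l *: x + (1 - l) *: y) <= l * F x + (1 - l) * F y.
Proof.
split=> [cF l x y l0 l1|cF t x y _ _].
  by have := cF (Itv01 l0 l1) x y; rewrite !inE => /(_ I I).
exact: cF (ge0 t) (le1 t).
Qed.

Lemma convex_midpoint F x y : convex_on_space F ->
  2 * F (2^-1 *: (x + y)) <= F x + F y.
Proof.
move=> /convex_on_spaceP /(_ 2^-1 x y).
rewrite (_ : 1 - 2^-1 = 2^-1 :> R); last by field.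
rewrite -scalerDr => h.
have h1 : 2^-1 <= 1 :> R by lra.
by have := h ltac:(by rewrite invr_ge0) h1; lra.
Qed.

(** For [0 < t <= 1] convexity bounds the difference quotient by [F (x + h) - F x]; a small [t]
    brings it within [e] of the derivative. *)
Lemma differentiable_convex_ge F x h : convex_on_space F -> differentiable F x ->
  F x + frechet F x h <= F (x + h).
Proof.
move=> /convex_on_spaceP cF dF; rewrite frechetE// -deriveE//.
apply/ler_addgt0Pr => e e0.
have : derivable F x h by exact: diff_derivable.
move=> /cvgrPdist_le/(_ e e0); rewrite -/(derive F x h) => H.
have [t [t0 t1 ht]] : exists t : R, [/\ 0 < t, t <= 1 &
    `|'D_h F x - t^-1 * (F (t *: h + x) - F x)| <= e].
  move: H => /nbhs_normP[r /= r0 H].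
  pose t := Num.min (r / 2) 1; have t0 : 0 < t by rewrite lt_min ltr01 divr_gt0.
  exists t; split=> //; first by rewrite ge_min lexx orbT.
  apply: H; last by rewrite gt_eqF.
  rewrite /= sub0r normrN gtr0_norm// (@le_lt_trans _ _ (r / 2))//.
    by rewrite ge_min lexx.
  by rewrite ltr_pdivrMr// ltr_pMr// ltr1n.
have := cF t (x + h) x (ltW t0) t1.
rewrite (_ : t *: (x + h) + (1 - t) *: x = t *: h + x); last first.
  by rewrite scalerDr scalerBl scale1r addrC addrA subrK addrC.
move=> H1; have {}H1 : t^-1 * (F (t *: h + x) - F x) <= F (x + h) - F x.
  by rewrite ler_pdivrMl//; lra.
by have := ler_norm ('D_h F x - t^-1 * (F (t *: h + x) - F x)); lra.
Qed.

(** The upper bound applied to [- h] supplies the lower one. *)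
Lemma bounded_linear_functional_continuous (p : X -> R^o) (B : R) : linear p ->
  (forall h, `|h| <= 1 -> p h <= B) -> continuous p.
Proof.
move=> lp pB.
pose HL := GRing.isLinear.Build R X R^o *:%R p lp.
pose pl : {linear X -> R^o} := HB.pack p HL.
apply: (@bounded_linear_continuous _ _ _ pl).
apply/ex_bound; exists B; apply/nbhs_norm0P; exists 1 => //= h /= h1.
rewrite ler_norml; apply/andP; split; last exact/pB/ltW.
by rewrite lerNl -(linearN pl); apply: pB; rewrite normrN ltW.
Qed.

Section primitive_expansion.
Variables (omega : R -> R) (modw : modulus_of_continuity omega).
Notation phi := (modulus_primitive omega).

(** As [phi s <= s * omega s] and [omega] vanishes at [0+], the right side is [o(t)]. Limits
    [t -> 0] in the linearity proofs and in the identification of the gradient on [E] go through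
    this lemma. *)
Lemma le0_of_primitive_bound (a b K : R) : 0 <= K -> 0 <= b ->
  (forall t, 0 < t -> t * a <= K * phi (t * b)) -> a <= 0.
Proof.
move=> K0 b0 H; apply/ler_addgt0Pr => e e0; rewrite add0r.
have [b_eq0|b_neq0] := eqVneq b 0.
  by have := H 1 ltr01; rewrite b_eq0 mulr0 primitive0; lra.
have {}b0 : 0 < b by rewrite lt_neqAle eq_sym b_neq0.
have e'0 : 0 < e / (K * b + 1) by rewrite divr_gt0// ltr_wpDl// mulr_ge0// ltW.
have /cvgrPdist_le/(_ _ e'0) := modulus_right0 modw.
move=> H0.
have [s [s0 hs]] : exists s : R, 0 < s /\ omega s <= e / (K * b + 1).
  near (0 : R)^'+ => s; exists s; split=> //.
  suff : `|0 - omega s| <= e / (K * b + 1).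
    by rewrite sub0r normrN ger0_norm// (modulus_ge0 modw).
  by near: s.
have t0 : 0 < s / b by rewrite divr_gt0.
have := H _ t0; rewrite divfK ?gt_eqF// => H1.
have {}H1 : s / b * a <= K * (s * omega s).
  by apply: (le_trans H1); rewrite ler_wpM2l// primitive_le// ltW.
have {}H1 : a <= K * b * omega s.
  rewrite -(ler_pM2l t0); apply: (le_trans H1).
  suff -> : s / b * (K * b * omega s) = K * (s * omega s) by [].
  by field; rewrite gt_eqF.
apply: (le_trans H1).
have Kb : 0 <= K * b by rewrite mulr_ge0// ltW.
apply: (le_trans (ler_wpM2l Kb hs)).
rewrite mulrCA ler_piMr ?(ltW e0)// ler_pdivrMr ?ltr_wpDl//; lra.
Unshelve. all: by end_near. Qed.

(** The remainder is at most [K * |h| * omega |h|], hence [o(|h|)], and the differential is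
    unique. *)
Lemma frechet_of_expansion F x (l : dual X) (K : R) : 0 <= K ->
  (forall h, `|F (x + h) - F x - l h| <= K * phi `|h|) ->
  differentiable F x /\ frechet F x = l.
Proof.
move=> K0 H.
have cl : continuous (l : {linear X -> R^o}) by exact: dual_continuous.
have e : F \o shift x = cst (F x) + (l : X -> R^o) +o_ 0 id.
  apply/eqaddoP => e e0.
  have e'0 : 0 < e / (K + 1) by rewrite divr_gt0// ltr_wpDl.
  have /cvgrPdist_le/(_ _ e'0) := modulus_right0 modw.
  move=> /nbhs_normP[r /= r0 Hr].
  apply/nbhs_norm0P; exists r => //= h /= hr.
  rewrite (_ : _ h = F (x + h) - F x - l h); last first.
    transitivity (F (h + x) - (F x + l h)) => //.
    by rewrite (addrC h) opprD addrA.
  apply: (le_trans (H h)).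
  have [->|h0] := eqVneq h 0; first by rewrite normr0 primitive0 !mulr0.
  have h0' : 0 < `|h| by rewrite normr_gt0.
  have wh : omega `|h| <= e / (K + 1).
    have := Hr `|h|; rewrite /= !sub0r !normrN normr_id => /(_ hr h0').
    by rewrite ger0_norm// (modulus_ge0 modw).
  apply: (@le_trans _ _ (K * (`|h| * (e / (K + 1))))).
    rewrite ler_wpM2l//; apply: le_trans (primitive_le modw (ltW h0')) _.
    by rewrite ler_wpM2l// ltW.
  rewrite mulrCA [leRHS]mulrC ler_wpM2l// mulrCA ler_piMr ?(ltW e0)//.
  by rewrite ler_pdivrMr ?ltr_wpDl//; lra.
have du := diff_unique cl e.
have dF : differentiable F x by apply/diff_locallyP; rewrite du.
by split=> //; apply/val_inj; rewrite /= frechetE.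
Qed.

End primitive_expansion.
End convex_first_order.

(** * Linearity of the one-sided directional derivative of a convex function *)

Section convex_gradient.
Context {R : realType} {X : normedModType R}.
Variables (omega : R -> R) (modw : modulus_of_continuity omega).
Notation phi := (modulus_primitive omega).
Variables (F : X -> R) (x : X) (K B : R).
Hypotheses (cF : convex_on_space F) (K0 : 0 <= K).
Hypothesis second_difference :
  forall h, F (x + h) + F (x - h) - 2 * F x <= K * phi `|h|.
Hypothesis ball_bounded : forall h, `|h| <= 1 -> F (x + h) <= B.

Let quotients h := [set (F (x + t *: h) - F x) / t | t in [set t | 0 < t]].
(** For convex [F] the quotients are non-decreasing in [t], so this infimum is the one-sided
    directional derivative along [h]. *)
Let p h := inf (quotients h).

(** The point [x] is the convex combination of [x + t *: h] and [x - h] with weights [1 / (1 + t)]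
    and [t / (1 + t)]. This makes the infimum [p h] finite. *)
Let quotient_ge (h : X) (t : R) : 0 < t ->
  F x - F (x - h) <= (F (x + t *: h) - F x) / t.
Proof.
move=> t0; have t1 : 0 < 1 + t by rewrite addr_gt0.
have /convex_on_spaceP/(_ (1 + t)^-1 (x + t *: h) (x - h)) := cF.
have -> : 1 - (1 + t)^-1 = (1 + t)^-1 * t by field; rewrite gt_eqF.
rewrite -scalerA -scalerDr.
have -> : x + t *: h + t *: (x - h) = (1 + t) *: x.
  by rewrite scalerBr addrACA subrr addr0 scalerDl scale1r.
rewrite scalerA mulVf ?gt_eqF// scale1r => H.
have i1 : (1 + t)^-1 <= 1 by rewrite invf_le1// lerDl ltW.
have {H} := H (ltac:(by rewrite invr_ge0 ltW)) i1.
rewrite -mulrA -mulrDr ler_pdivlMl// ler_pdivlMr// => H; nra.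
Qed.

Let has_inf_quotients h : has_inf (quotients h).
Proof.
split; first by exists ((F (x + 1 *: h) - F x) / 1); exists 1 => //=.
exists (F x - F (x - h)) => _ [t /= t0 <-]; exact: quotient_ge.
Qed.

Let p_le (h : X) (t : R) : 0 < t -> t * p h <= F (x + t *: h) - F x.
Proof.
move=> t0; rewrite mulrC -ler_pdivlMr//; apply: inf_lbound; last by exists t.
by case: (has_inf_quotients h).
Qed.

Let p_ge (h : X) (t : R) : 0 < t -> F x - F (x - t *: h) <= t * p h.
Proof.
move=> t0; rewrite mulrC -ler_pdivrMr//.
apply: lb_le_inf; first by case: (has_inf_quotients h).
move=> _ [s /= s0 <-]; rewrite ler_pdivrMr//.
have := @quotient_ge (t *: h) (s / t) (divr_gt0 s0 t0).
by rewrite scalerA divfK ?gt_eqF// invf_div mulrA (mulrAC _ t).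
Qed.

(** The second-difference bound replaces the forward increment by the backward one, which [p_ge]
    controls. *)
Let p_expansion (h : X) (t : R) : 0 < t ->
  F (x + t *: h) - F x <= t * p h + K * phi (t * `|h|).
Proof.
move=> t0; have := second_difference (t *: h).
by rewrite normrZ gtr0_norm//; have := p_ge h t0; lra.
Qed.

Let p_scale (c : R) h : 0 < c -> p (c *: h) = c * p h.
Proof.
move=> c0; apply/eqP; rewrite eq_le; apply/andP; split; rewrite -subr_le0.
  apply: (le0_of_primitive_bound modw K0 (b := c * `|h|)).
    by rewrite mulr_ge0// ltW.
  move=> t t0; have tc : 0 < t * c by rewrite mulr_gt0.
  have := p_le (c *: h) t0; have := p_expansion h tc.
  by rewrite scalerA -(mulrA t c `|h|); lra.
apply: (le0_of_primitive_bound modw K0 (b := c * `|h|)).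
  by rewrite mulr_ge0// ltW.
move=> t t0; have tc : 0 < t * c by rewrite mulr_gt0.
have := p_le h tc; have := p_expansion (c *: h) t0.
by rewrite scalerA normrZ (gtr0_norm c0); lra.
Qed.

Let p_subadd h k : p (h + k) <= p h + p k.
Proof.
rewrite -subr_le0; apply: (le0_of_primitive_bound modw K0 (b := 2 * (`|h| + `|k|))).
  by rewrite mulr_ge0// addr_ge0.
move=> t t0; have t2 : 0 < t * 2 by rewrite mulr_gt0.
have := p_le (h + k) t0.
(* The steps are doubled so that the midpoint is [x + t *: (h + k)]. *)
have := convex_midpoint (x + (t * 2) *: h) (x + (t * 2) *: k) cF.
have -> : 2^-1 *: (x + (t * 2) *: h + (x + (t * 2) *: k)) = x + t *: (h + k).
  rewrite addrACA -scalerDr [LHS]scalerDr scalerA; congr (_ + _ *: _).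
    by rewrite -mulr2n -[x *+ 2]scaler_nat scalerA mulVf// scale1r.
  by field.
have := p_expansion h t2; have := p_expansion k t2.
have le1 : K * phi (t * 2 * `|h|) <= K * phi (t * (2 * (`|h| + `|k|))).
  apply: ler_wpM2l => //; apply: primitive_nd => //.
    by rewrite mulr_ge0// ltW.
  by rewrite -mulrA ler_pM2l// ler_pM2l// lerDl.
have le2 : K * phi (t * 2 * `|k|) <= K * phi (t * (2 * (`|h| + `|k|))).
  apply: ler_wpM2l => //; apply: primitive_nd => //.
    by rewrite mulr_ge0// ltW.
  by rewrite -mulrA ler_pM2l// ler_pM2l// lerDr.
lra.
Qed.

(** The small second difference forces [p h + p (- h) <= 0]; [p_ge] with [p_expansion] gives the
    reverse inequality. *)
Let p_opp h : p (- h) = - p h.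
Proof.
apply/eqP; rewrite eq_le; apply/andP; split; rewrite -subr_le0.
  apply: (le0_of_primitive_bound modw K0 (normr_ge0 h)) => t t0.
  have := p_le h t0; have := p_le (- h) t0.
  have := second_difference (t *: h); rewrite normrZ gtr0_norm// scalerN; lra.
apply: (le0_of_primitive_bound modw K0 (normr_ge0 h)) => t t0.
have := p_ge h t0; have := p_expansion (- h) t0.
by rewrite scalerN normrN; lra.
Qed.

Let p_linear : linear (p : X -> R^o).
Proof.
have padd h k : p (h + k) = p h + p k.
  apply/eqP; rewrite eq_le p_subadd/= -lerBrDr.
  by have := p_subadd (h + k) (- k); rewrite addrK p_opp.
have p0 : p 0 = 0 by have := padd 0 0; rewrite addr0; lra.
move=> a h k; rewrite padd; congr (_ + _).
have [a0|a0|->] := ltgtP a 0; last by rewrite !scale0r.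
  by rewrite -[a *: h]opprK -scaleNr p_opp p_scale ?oppr_gt0// mulNr opprK.
exact: p_scale.
Qed.

(** The functional is [p] itself: linear, and bounded above on the unit ball because [F] is, hence
    continuous. *)
Lemma convex_gradient : exists l : dual X,
  forall h, 0 <= F (x + h) - F x - l h <= K * phi `|h|.
Proof.
have pB h : `|h| <= 1 -> p h <= B - F x.
  move=> /ball_bounded Bh; have := p_le h ltr01.
  by rewrite mul1r scale1r; lra.
have pP : (p : X -> R^o) \in continuous_functional.
  rewrite inE; split; first exact: p_linear.
  exact: bounded_linear_functional_continuous pB.
exists (Dual pP) => h /=.
have := p_le h ltr01; have := p_expansion h ltr01.
by rewrite !mul1r scale1r => h1 h2; apply/andP; split; lra.
Qed.

End convex_gradient.

(** * First-order expansions and the modulus of the derivative *)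

Section supremum_ereal.
Context {R : realType}.
Implicit Type S : set (\bar R).

Lemma supremum_le S (x0 b : \bar R) : (x0 <= b)%E ->
  (forall q, S q -> (q <= b)%E) -> (supremum x0 S <= b)%E.
Proof.
move=> x0b Sb; rewrite /supremum; case: ifPn => // S0.
by have [_] := xgetPex x0 (ereal_supremums_neq0 S); apply.
Qed.

Lemma supremum_ge S (x0 q : \bar R) : S q -> (q <= supremum x0 S)%E.
Proof. exact/ge_supremum_Nmem/ereal_supremums_neq0. Qed.

End supremum_ereal.

Section smooth_convex.
Context {R : realType} {X : normedModType R}.
Variables (omega : R -> R) (modw : modulus_of_continuity omega).
Notation phi := (modulus_primitive omega).

Lemma dualD (l : dual X) (u v : X) : l (u + v) = l u + l v.
Proof. exact: linearD. Qed.

Lemma dualN (l : dual X) (u : X) : l (- u) = - l u.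
Proof. exact: linearN. Qed.

Lemma dualZ (l : dual X) (a : R) (u : X) : l (a *: u) = a * l u.
Proof. exact: linearZ. Qed.

Lemma dual_le (l : dual X) (r : R) : 0 <= r -> (forall v, `|v| <= 1 -> l v <= r) ->
  `|l| <= r.
Proof.
move=> r0 H; apply: le_dual_norm => v v1; rewrite ler_norml H// andbT.
by rewrite lerNl -dualN H// normrN.
Qed.

Lemma dual_le_norm (l : dual X) (v : X) : l v <= `|l| * `|v|.
Proof. exact: le_trans (ler_norm _) (dual_normP l v). Qed.

Section smooth.
Variables (F : X -> R) (A : R) (A0 : 0 <= A).
Hypothesis dF : forall x, differentiable F x.
Hypothesis F_expansion : forall x h : X,
  0 <= F (x + h) - F x - frechet F x h <= A * phi `|h|.

(** The value at [z + h] is bounded below from [y] and above from [z], the value at [y - h] below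
    from [z] and above from [y]. Adding the four bounds cancels every value of [F]. *)
Lemma frechet_difference_le (y z h : X) :
  2 * (frechet F y h - frechet F z h)
    - (frechet F y (y - z) - frechet F z (y - z)) <= 2 * (A * phi `|h|).
Proof.
have arith (fy fz fzh fyh yh zh yd zd B : R) :
    0 <= fzh - fy - (- yd + yh) -> 0 <= fyh - fz - (zd - zh) ->
    fzh - fz - zh <= B -> fyh - fy - - yh <= B ->
    2 * (yh - zh) - (yd - zd) <= 2 * B by lra.
have /andP[y1 _] := F_expansion y (z + h - y).
have /andP[_ z1] := F_expansion z h.
have /andP[z2 _] := F_expansion z (y - h - z).
have /andP[_ y2] := F_expansion y (- h).
rewrite (addrC y) subrK (addrAC z) dualD -(opprB y z) dualN in y1.
rewrite (addrC z) subrK (addrAC y) dualD dualN in z2.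
rewrite dualN normrN in y2.
exact: arith y1 z2 z1 y2.
Qed.

(* Testing the directions of norm [2 * `|y - z|] gives the constant 4/3. *)
Lemma frechet_modulus (y z : X) :
  `|frechet F y - frechet F z| <= 4 / 3 * A * omega `|y - z|.
Proof.
have [->|yz] := eqVneq y z; first by rewrite !subrr !normr0 (modulus0 modw) mulr0.
set d := `|y - z|; have d0 : 0 < d by rewrite normr_gt0 subr_eq0.
pose D : dual X := frechet F y - frechet F z; rewrite -/D.
have DE u : D u = frechet F y u - frechet F z u by [].
have w0 := modulus_ge0 modw (ltW d0).
(* The last term comes from [D (y - z) <= |D| * d]; absorbing it on the left leaves
   [3 / 4 * |D|]. *)
suff : `|D| <= A * omega d + `|D| / 4.
  by rewrite -[_ * A * _]mulrA; move: (A * _) `|D| => B N; lra.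
apply: dual_le; first by rewrite addr_ge0 ?divr_ge0 ?mulr_ge0.
move=> v v1; have := frechet_difference_le y z ((2 * d) *: v); rewrite -!DE dualZ.
have hd : A * phi `|(2 * d) *: v| <= A * (2 * d * omega d).
  apply: ler_wpM2l => //; apply: le_trans (primitive_double modw d0).
  by apply: primitive_nd => //; rewrite normrZ ger0_norm ?mulr_ge0 ?(ltW d0)//
    ler_piMr// mulr_ge0// ltW.
move=> /le_trans/(_ (ler_wpM2l (ler0n R 2) hd)).
rewrite lerBlDr => /le_trans/(_ (lerD (lexx _) (dual_le_norm D (y - z)))).
rewrite -/d (_ : 2 * (2 * d * D v) = d * (4 * D v)); last by ring.
rewrite (_ : _ + _ = d * (4 * (A * omega d) + `|D|)); last by ring.
by rewrite ler_pM2l//; move: (A * _) (D v) `|D| => B u N; lra.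
Qed.

Lemma smooth_convex_C1 : C1_modulus omega F.
Proof.
split=> //.
  move=> x; apply/cvgrPdist_le => e e0.
  have e'0 : 0 < e / (4 / 3 * A + 1) by rewrite divr_gt0// ltr_wpDl// !mulr_ge0.
  have /cvgrPdist_le/(_ _ e'0) := modulus_right0 modw.
  move=> /nbhs_normP[r /= r0 Hr].
  apply/nbhs_normP; exists r => //= y /= yr.
  apply: (le_trans (frechet_modulus _ _)).
  have [->|xy] := eqVneq x y.
    by rewrite subrr normr0 (modulus0 modw) mulr0 ltW.
  have xy0 : 0 < `|x - y| by rewrite normr_gt0 subr_eq0.
  have := Hr `|x - y|; rewrite /= !sub0r !normrN normr_id => /(_ yr xy0).
  rewrite ger0_norm ?(modulus_ge0 modw)// ler_pdivlMr ?ltr_wpDl ?mulr_ge0//.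
  apply: le_trans; rewrite mulrC ler_wpM2l ?(modulus_ge0 modw)//; lra.
apply: (@le_lt_trans _ _ (4 / 3 * A)%:E); last exact: ltry.
apply: supremum_le; first by rewrite lee_fin !mulr_ge0.
move=> _ [x [z [_ _ xz ->]]]; rewrite lee_fin ler_pdivrMr ?frechet_modulus//.
by apply: modulus_gt0 => //; rewrite normr_gt0 subr_eq0.
Qed.

Lemma smooth_convex_Lip : (Lip_modulus omega (frechet F) setT <= (4 / 3 * A)%:E)%E.
Proof.
apply: supremum_le; first by rewrite lee_fin !mulr_ge0.
move=> _ [x [z [_ _ xz ->]]]; rewrite lee_fin ler_pdivrMr ?frechet_modulus//.
by apply: modulus_gt0 => //; rewrite normr_gt0 subr_eq0.
Qed.

(** The lower expansion at [z] and the upper one at [y], both evaluated at [x], cancel [F x]. *)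
Lemma smooth_convex_A_co : (A_co omega F (frechet F) setT <= A%:E)%E.
Proof.
apply: supremum_le; first by rewrite lee_fin.
have arith (fx fy fz yd zd B : R) :
  0 <= fx - fz - zd -> fx - fy - yd <= B -> fz + zd - fy - yd <= B by lra.
move=> _ [y [z [x [_ _ xy ->]]]].
have xy0 : 0 < `|x - y| by rewrite normr_gt0 subr_eq0.
rewrite lee_fin ler_pdivrMr ?primitive_gt0//.
have /andP[z1 _] := F_expansion z (x - z).
have /andP[_ y1] := F_expansion y (x - y).
rewrite (addrC z) subrK in z1; rewrite (addrC y) subrK in y1.
exact: arith z1 y1.
Qed.

End smooth.

Lemma Lip_modulus_ge0 (Y : normedModType R) (w : R -> R) (H : X -> Y) (E : set X) :
  (forall t, 0 <= t -> 0 <= w t) -> (0 <= Lip_modulus w H E)%E.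
Proof.
move=> w0; rewrite /Lip_modulus; set S := (X in supremum _ X).
(* Without two distinct points in [E] the supremum takes its default value [0]. *)
have [->|/set0P[q Sq]] := eqVneq S set0; first by rewrite supremum0.
apply: (le_trans _ (supremum_ge 0%E Sq)).
by case: Sq => x [z [_ _ _ ->]]; rewrite lee_fin divr_ge0// w0.
Qed.

Lemma C1_modulus_bound (F : X -> R) : C1_modulus omega F ->
  exists2 M, 0 <= M &
    forall x z, `|frechet F x - frechet F z| <= M * omega `|x - z|.
Proof.
move=> [_ _ finL]; exists (fine (Lip_modulus omega (frechet F) setT)).
  by rewrite fine_ge0// Lip_modulus_ge0//; exact: modulus_ge0.
move=> x z; have [->|xz] := eqVneq x z.
  by rewrite !subrr !normr0 (modulus0 modw) mulr0.
have w0 : 0 < omega `|x - z|.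
  by apply: modulus_gt0 => //; rewrite normr_gt0 subr_eq0.
rewrite -ler_pdivrMr// -lee_fin.
have le : ((`|frechet F x - frechet F z| / omega `|x - z|)%:E <=
    Lip_modulus omega (frechet F) setT)%E.
  by apply: supremum_ge; exists x, z.
rewrite fineK// fin_numElt finL andbT.
by apply: lt_le_trans le; exact: ltNyr.
Qed.

(** [F x] lies above the tangent at [z], and the tangent inequality at [x] evaluated at [y] bounds
    [F x] by the tangent at [y] plus [(DF x - DF y)(x - y)]. *)
Lemma C1_convex_extension_jet (E : set X) (f F : X -> R) (G : X -> dual X) :
  C1_convex_extension omega E f G F ->
  exists2 M, 0 < M & jet_condition omega E f G M.
Proof.
move=> [cF C1F FG]; have [M M0 HM] := C1_modulus_bound C1F.
have [dF _ _] := C1F.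
(* The factor [4] comes from [primitive_ge]; the summand [1] keeps the constant positive when
   [M = 0]. *)
exists (4 * M + 1); first by lra.
have arith (fx fy xd yd B : R) :
  fx + - xd <= fy -> xd - yd <= B -> fx <= fy + yd + B by lra.
move=> y z x /FG[<- <-] /FG[<- <-].
have := differentiable_convex_ge (x - z) cF (dF z).
have := differentiable_convex_ge (y - x) cF (dF x).
rewrite ![_ + (_ - _)]addrC !subrK -(opprB x y) dualN.
move=> yx zx; have xy : (frechet F x - frechet F y) (x - y) <= (4 * M + 1) * phi `|x - y|.
  apply: le_trans (dual_le_norm _ _) _.
  apply: le_trans (ler_wpM2r (normr_ge0 _) (HM x y)) _.
  rewrite -mulrA (mulrC (omega _)).
  apply: le_trans (ler_wpM2l M0 (primitive_ge modw (normr_ge0 _))) _.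
  by rewrite mulrA (mulrC M) ler_wpM2r ?primitive_ge0// lerDl.
apply: (le_trans zx).
exact: arith yx xy.
Qed.

End smooth_convex.

(** * Convex envelopes *)

Section envelope.
Context {R : realType} {X : normedModType R}.
Variables (omega : R -> R) (modw : modulus_of_continuity omega).
Notation phi := (modulus_primitive omega).
Variables (E : set X) (f : X -> R) (G : X -> dual X) (M K : R).
Hypotheses (M0 : 0 < M) (K0 : 0 <= K) (E0 : E !=set0).
Hypothesis jet : jet_condition omega E f G M.
Hypothesis second_difference : forall x h : X,
  phi `|x + h| + phi `|x - h| - 2 * phi `|x| <= K * phi `|h|.
Let g := inf_envelope omega E f G M.

Let has_inf_g x :
  has_inf [set f y + G y (x - y) + M * phi `|x - y| | y in E].
Proof.
have [z Ez] := E0; split; first by exists (f z + G z (x - z) + M * phi `|x - z|), z.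
by exists (f z + G z (x - z)) => _ [y Ey <-]; exact: jet.
Qed.

Lemma jet_le_inf_envelope z x : E z -> f z + G z (x - z) <= g x.
Proof.
move=> Ez; apply: lb_le_inf; first by case: (has_inf_g x).
by move=> _ [y Ey <-]; exact: jet.
Qed.

Lemma inf_envelope_le y x : E y -> g x <= f y + G y (x - y) + M * phi `|x - y|.
Proof.
by move=> Ey; apply: inf_lbound; [case: (has_inf_g x)|exists y].
Qed.

(** The same [y] is used at [x + h], [x - h] and [x]: the affine parts cancel and only the second
    difference of [phi] of the norm remains. *)
Lemma inf_envelope_second_difference x h :
  2^-1 * (g (x + h) + g (x - h) - K * M * phi `|h|) <= g x.
Proof.
apply: lb_le_inf; first by case: (has_inf_g x).
have arith (gp gm fy l lh p q r s : R) : gp <= fy + (l + lh) + p ->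
    gm <= fy + (l - lh) + q -> p + q - 2 * r <= s ->
    2^-1 * (gp + gm - s) <= fy + l + r by lra.
move=> _ [y Ey <-].
have gp := inf_envelope_le (x + h) Ey; have gm := inf_envelope_le (x - h) Ey.
rewrite (addrAC x) dualD in gp; rewrite (addrAC x) dualD dualN in gm.
apply: arith gp gm _.
by rewrite mulrCA -mulrDr -mulrBr (mulrC K) -mulrA ler_pM2l.
Qed.

Section admissible.
(** Stands for continuity or for the [L]-Lipschitz property, so that both envelopes are treated at
    once. *)
Variable admissible : (X -> R) -> Prop.
Hypothesis admissible_jet : forall z, E z -> admissible (fun x => f z + G z (x - z)).
Hypothesis admissible_average : forall (u v : X -> R) (h : X) (c : R),
  admissible u -> admissible v ->
  admissible (fun x => 2^-1 * (u (x + h) + v (x - h) - c)).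
Let minorants := [set u : X -> R |
  [/\ convex_on_space u, admissible u & forall y, u y <= g y]].
Let F x := sup [set u x | u in minorants].

Let jet_minorant z : E z -> minorants (fun x => f z + G z (x - z)).
Proof.
move=> Ez; split; [|exact: admissible_jet|by move=> y; exact: jet_le_inf_envelope].
apply/convex_on_spaceP => l x y l0 l1 /=.
rewrite (_ : l *: x + (1 - l) *: y - z = l *: (x - z) + (1 - l) *: (y - z)).
  rewrite (dualD _ (l *: _)) !dualZ le_eqVlt; apply/orP; left; apply/eqP.
  by move: (G z _) (G z _) => a b; ring.
rewrite !scalerBr addrACA -opprD -scalerDl (_ : l + (1 - l) = 1) ?scale1r//.
by ring.
Qed.

Let has_sup_F x : has_sup [set u x | u in minorants].
Proof.
have [z Ez] := E0; split.
  by exists (f z + G z (x - z)), (fun x => f z + G z (x - z)) => //; exact: jet_minorant.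
by exists (g x) => _ [u [_ _ ug] <-].
Qed.

Lemma envelope_ge u x : minorants u -> u x <= F x.
Proof. by move=> mu; apply: ub_le_sup; [case: (has_sup_F x)|exists u]. Qed.

Lemma envelope_le x (b : R) : (forall u, minorants u -> u x <= b) -> F x <= b.
Proof.
move=> Hb; apply: ge_sup; first by case: (has_sup_F x).
by move=> _ [u mu <-]; exact: Hb.
Qed.

Lemma envelope_le_inf_envelope x : F x <= g x.
Proof. by apply: envelope_le => u [_ _]. Qed.

Lemma envelope_lipschitz (L : R) :
  (forall u, admissible u -> forall x y, `|u x - u y| <= L * `|x - y|) ->
  forall x y, `|F x - F y| <= L * `|x - y|.
Proof.
move=> admL.
have le x y : F x <= F y + L * `|x - y|.
  apply: envelope_le => u mu; have [_ au _] := mu.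
  rewrite -lerBlDl; apply: le_trans (admL _ au x y).
  by apply: le_trans (ler_norm _); rewrite lerD2l lerN2 envelope_ge.
by move=> x y; rewrite ler_distlC !lerBlDr le distrC le.
Qed.

Lemma envelope_convex : convex_on_space F.
Proof.
apply/convex_on_spaceP => l x y l0 l1; apply: envelope_le => u mu.
have [/convex_on_spaceP cu _ _] := mu.
apply: (le_trans (cu _ _ _ l0 l1)).
by apply: lerD; apply: ler_wpM2l; rewrite ?subr_ge0//; exact: envelope_ge.
Qed.

(* Averaging two translates of a minorant of [g] gives again a minorant of [g],
   so second-difference bounds pass to the envelope. *)
Lemma envelope_second_difference x h :
  F (x + h) + F (x - h) - 2 * F x <= K * M * phi `|h|.
Proof.
set c := K * M * phi `|h|.
have avg u v : minorants u -> minorants v -> u (x + h) + v (x - h) <= 2 * F x + c.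
  move=> [/convex_on_spaceP cu au ug] [/convex_on_spaceP cv av vg].
  pose w y := 2^-1 * (u (y + h) + v (y - h) - c).
  suff /(envelope_ge x) : minorants w.
    have arith (a b d e : R) : 2^-1 * (a + b - d) <= e -> a + b <= 2 * e + d by lra.
    exact: arith.
  split; last 2 first.
  - exact: admissible_average.
  - move=> y; apply: le_trans (inf_envelope_second_difference y h).
    by rewrite ler_pM2l ?invr_gt0// lerD2r lerD.
  apply/convex_on_spaceP => l y z l0 l1.
  have shift (k : X) : l *: y + (1 - l) *: z + k = l *: (y + k) + (1 - l) *: (z + k).
    rewrite !scalerDr addrACA -scalerDl (_ : l + (1 - l) = 1) ?scale1r//.
    by ring.
  have arith (a b a' b' a'' b'' : R) : a <= l * a' + (1 - l) * a'' ->
      b <= l * b' + (1 - l) * b'' ->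
      2^-1 * (a + b - c) <=
      l * (2^-1 * (a' + b' - c)) + (1 - l) * (2^-1 * (a'' + b'' - c)).
    by lra.
  by rewrite /w !shift; apply: arith; [exact: cu|exact: cv].
(* The suprema at [x + h] and [x - h] are taken one after the other, each with the other minorant
   fixed. *)
rewrite lerBlDr -lerBrDr; apply: envelope_le => u mu.
rewrite lerBrDr -lerBrDl; apply: envelope_le => v mv.
rewrite lerBrDl [leRHS]addrC.
exact: avg.
Qed.

(** [F <= g] lies below the function attached to any single [z] in [E], which is bounded on
    balls. *)
Lemma envelope_ball_bounded x :
  exists B, forall h, `|h| <= 1 -> F (x + h) <= B.
Proof.
have [z Ez] := E0; pose r := `|x - z| + 1.
exists (f z + `|G z| * r + M * phi r) => h h1.
apply: le_trans (envelope_le_inf_envelope _) _.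
apply: le_trans (inf_envelope_le _ Ez) _.
have hr : `|x + h - z| <= r by rewrite addrAC (le_trans (ler_normD _ _))// lerD.
apply: lerD; last by rewrite ler_pM2l// primitive_nd.
by rewrite lerD2l; apply: le_trans (dual_le_norm _ _) _; rewrite ler_wpM2l.
Qed.

Lemma envelope_expansion x :
  differentiable F x /\ (forall h : X,
    0 <= F (x + h) - F x - frechet F x h <= K * M * phi `|h|).
Proof.
have KM : 0 <= K * M by rewrite mulr_ge0// ltW.
have [B FB] := envelope_ball_bounded x.
have [l lP] := convex_gradient modw envelope_convex KM
  (envelope_second_difference x) FB.
suff [dF ->] : differentiable F x /\ frechet F x = l by [].
apply: (frechet_of_expansion modw KM) => h.
by have /andP[l1 l2] := lP h; rewrite ger0_norm.
Qed.

Lemma envelope_extension : C1_convex_extension omega E f G F.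
Proof.
have KM : 0 <= K * M by rewrite mulr_ge0// ltW.
have dF x := (envelope_expansion x).1.
have eF x := (envelope_expansion x).2.
split; [exact: envelope_convex|exact: (smooth_convex_C1 modw KM dF eF)|].
move=> z Ez.
have Gz h : f z + G z h <= F (z + h).
  have := envelope_ge (z + h) (jet_minorant Ez).
  by rewrite (addrC z) addrK.
(* At [x = z] the affine minorant of [z] and the upper bound of [g] by [z] have the same value
   [f z]. *)
have Fz : F z = f z.
  apply/eqP; rewrite eq_le; apply/andP; split.
    apply: le_trans (envelope_le_inf_envelope _) _.
    apply: le_trans (inf_envelope_le _ Ez) _.
    by rewrite subrr normr0 primitive0 mulr0 addr0 linear0 addr0.
  by have := Gz 0; rewrite addr0 linear0 addr0.
split=> //; apply/val_inj/funext => h /=.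
(* The affine minorant touches [F] at [z], so along [t *: h'] its slope exceeds that of [F] by at
   most [o(t) / t]. Using [- h] as well gives equality. *)
have le h' : G z h' <= frechet F z h'.
  rewrite -subr_le0; apply: (le0_of_primitive_bound modw KM (normr_ge0 h')) => t t0.
  have := Gz (t *: h'); have /andP[_] := eF z (t *: h').
  rewrite !dualZ Fz normrZ (gtr0_norm t0).
  have arith (a b c e k : R) :
    a - e - t * b <= k -> e + t * c <= a -> t * (c - b) <= k by lra.
  exact: arith.
apply/eqP; rewrite eq_le le andbT.
by have := le (- h); rewrite !dualN lerN2.
Qed.

Lemma envelope_A_co : (A_co omega F (frechet F) setT <= (K * M)%:E)%E.
Proof.
have KM : 0 <= K * M by rewrite mulr_ge0// ltW.
exact: (smooth_convex_A_co modw KM (fun x => (envelope_expansion x).2)).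
Qed.

Lemma envelope_Lip :
  (Lip_modulus omega (frechet F) setT <= (4 / 3 * (K * M))%:E)%E.
Proof.
have KM : 0 <= K * M by rewrite mulr_ge0// ltW.
exact: (smooth_convex_Lip modw KM (fun x => (envelope_expansion x).2)).
Qed.

End admissible.
End envelope.

(** * Equivalence of the jet condition with its Fenchel conjugate form *)

Section conjugate_condition.
Context {R : realType} {X : normedModType R}.
Variables (omega : R -> R) (modw : modulus_of_continuity omega).
Notation phi := (modulus_primitive omega).

(** One direction is the Fenchel-Young inequality at [s = |x - y|]. The other tests [x = y + s *: v]
    over the unit ball, which recovers [s * |G y - G z|], and then takes the supremum over [s]. *)
Lemma jet_conjugate_conditionE (E : set X) (f : X -> R) (G : X -> dual X) (M : R) :
  0 < M -> jet_conjugate_condition omega E f G M <-> jet_condition omega E f G M.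
Proof.
move=> M0.
have split_at (l : dual X) (x y z : X) : l (x - z) = l (y - z) + l (x - y).
  by rewrite -dualD (addrC (y - z)) subrKA.
have diffE (l k : dual X) v : (l - k) v = l v - k v by [].
split=> [H y z x Ey Ez|H y z Ey Ez].
  set s := `|x - y|; set d := `|G y - G z|.
  have fen : ((M^-1 * d * s - phi s)%:E <= fenchel_conjugate phi (M^-1 * d))%E.
    by apply: ereal_sup_ubound; exists s => //=; exact: normr_ge0.
  have M0' : (0 <= M%:E)%E by rewrite lee_fin ltW.
  have := le_trans (leeD2l _ (lee_wpmul2l M0' fen)) (H y z Ey Ez).
  rewrite -EFinM -EFinD lee_fin mulrBr !mulrA divff ?gt_eqF// mul1r.
  rewrite (split_at _ x y z) => fy.
  have := dual_le_norm (G z - G y) (x - y); rewrite distrC -/s -/d diffE.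
  have arith (a b c e fz m k : R) :
    fz + b + (e - m) <= k -> a - c <= e -> fz + (b + a) <= k + c + m by lra.
  exact: arith fy.
set a := f z + G z (y - z).
suff fen : (fenchel_conjugate phi (M^-1 * `|G y - G z|)%R <= (M^-1 * (f y - a))%:E)%E.
  have M0' : (0 <= M%:E)%E by rewrite lee_fin ltW.
  have := lee_wpmul2l M0' fen.
  by rewrite -EFinM mulrA divff ?gt_eqF// mul1r EFinB leeBrDl.
apply: ge_ereal_sup => _ [s /= s0 <-]; rewrite lee_fin ler_pdivlMl// mulrBr.
rewrite -mulrA mulVKf ?gt_eqF// (mulrC _ s) lerBlDr distrC.
have Hv v : `|v| <= 1 -> s * (G z - G y) v <= f y - a + M * phi s.
  move=> v1; have := H y z (y + s *: v) Ey Ez.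
  rewrite (addrAC y) dualD [y + _ - y]addrAC subrr add0r !dualZ diffE addrA -/a.
  have : M * phi `|s *: v| <= M * phi s.
    rewrite ler_pM2l//; apply: primitive_nd => //.
    by rewrite normrZ ger0_norm// ler_piMr.
  have arith (b c k m n e : R) :
    m <= n -> e + s * b <= k + s * c + m -> s * (b - c) <= k - e + n by lra.
  exact: arith.
rewrite [s * _](_ : _ = `|s *: (G z - G y)|); last by rewrite normrZ ger0_norm.
apply: dual_le => [|v v1]; last exact: Hv.
by have := Hv 0; rewrite normr0 linear0 mulr0; apply.
Qed.

End conjugate_condition.

(** * Stability of Lipschitz and continuous minorants under averaging of translates *)

Section lipschitz.
Context {R : realType} {X : normedModType R}.

Lemma lipschitz_setTP (L : R) (u : X -> R) :
  L.-lipschitz u <-> forall x y, `|u x - u y| <= L * `|x - y|.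
Proof.
split=> [H x y|H [x y] _ /=]; last exact: H.
by have := H (x, y); apply.
Qed.

Lemma lipschitz_average (L : R) (u v : X -> R) (h : X) (c : R) :
  L.-lipschitz u -> L.-lipschitz v ->
  L.-lipschitz (fun x => 2^-1 * (u (x + h) + v (x - h) - c)).
Proof.
move=> /lipschitz_setTP Lu /lipschitz_setTP Lv; apply/lipschitz_setTP => x y.
have e (k : X) : x + k - (y + k) = x - y by rewrite opprD addrACA subrr addr0.
have := Lu (x + h) (y + h); have := Lv (x - h) (y - h); rewrite !e.
have arith (a a' b b' k : R) : `|b - b'| <= k -> `|a - a'| <= k ->
    `|2^-1 * (a + b - c) - 2^-1 * (a' + b' - c)| <= k.
  rewrite !ler_norml => /andP[b1 b2] /andP[a1 a2]; lra.
exact: arith.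
Qed.

Lemma lipschitz_jet (L : R) (G : dual X) (c : R) (z : X) : `|G| <= L ->
  L.-lipschitz (fun x => c + G (x - z)).
Proof.
move=> GL; apply/lipschitz_setTP => x y.
rewrite opprD addrACA subrr add0r -dualN -dualD opprB addrA subrK.
by apply: le_trans (dual_normP G _) _; rewrite ler_wpM2r.
Qed.

Lemma continuous_average (u v : X -> R) (h : X) (c : R) :
  continuous u -> continuous v ->
  continuous (fun x => 2^-1 * (u (x + h) + v (x - h) - c)).
Proof.
move=> cu cv x.
have ct (w : X -> R) (k : X) : continuous w -> {for x, continuous (fun y => w (y + k))}.
  move=> cw; apply: (@continuous_comp _ _ _ (fun y => y + k) w); last exact: cw.
  by apply: cvgD; [exact: cvg_id|exact: cvg_cst].
apply: cvgM; first exact: cvg_cst.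
by apply: cvgB; [apply: cvgD; exact: ct|exact: cvg_cst].
Qed.

Lemma continuous_jet (G : dual X) (c : R) (z : X) :
  continuous (fun x => c + G (x - z)).
Proof.
move=> x; apply: cvgD; first exact: cvg_cst.
apply: (@continuous_comp _ _ _ (fun y => y - z) G); last exact: dual_continuous.
by apply: cvgB; [exact: cvg_id|exact: cvg_cst].
Qed.

End lipschitz.

(** * Sharp Lipschitz constant of the extension *)

Section lipschitz_extension.
Context {R : realType} {X : normedModType R}.
Variables (omega : R -> R) (E : set X) (f : X -> R) (G : X -> dual X).
Variable F : X -> R.
Hypothesis extF : C1_convex_extension omega E f G F.

(** Passes from the real supremum defining [L] to extended ones; nonemptiness excludes [s = -oo]. *)
Lemma sup_EFin_le (A : set R) (s : \bar R) : A !=set0 ->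
  (forall a, A a -> (a%:E <= s)%E) -> ((sup A)%:E <= s)%E.
Proof.
move=> A0; case: s => [r||] H; [|exact: leey|].
  by rewrite lee_fin; apply: ge_sup => // a /H; rewrite lee_fin.
by have [a /H] := A0; rewrite leeNy_eq.
Qed.

Lemma gradient_le_increment x v : frechet F x v <= F (x + v) - F x.
Proof.
have [cF [dF _ _] _] := extF.
by rewrite lerBrDl; exact: differentiable_convex_ge.
Qed.

Variable L : R.
Hypotheses (E0 : E !=set0) (LE : L = sup [set `|G z| | z in E]) (L0 : 0 <= L).
Hypothesis lipF : forall x y, `|F x - F y| <= L * `|x - y|.

Lemma lipschitz_extension_sup_frechet :
  ereal_sup [set `|frechet F x|%:E | x in [set: X]] = L%:E.
Proof.
have [_ _ FG] := extF; apply/eqP; rewrite eq_le; apply/andP; split.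
  apply: ge_ereal_sup => _ [x _ <-]; rewrite lee_fin; apply: dual_le => // v v1.
  apply: le_trans (gradient_le_increment _ _) _.
  apply: le_trans (ler_norm _) _; apply: le_trans (lipF _ _) _.
  by rewrite addrAC subrr add0r ler_piMr.
rewrite LE; apply: sup_EFin_le; first by have [z Ez] := E0; exists `|G z|, z.
move=> _ [z Ez <-]; apply: ereal_sup_ubound; exists z => //.
by rewrite (FG z Ez).2.
Qed.

(** For the lower bound, [G z v = DF z v <= F (z + v) - F z] at each [z] in [E], so every [|G z|] is
    at most the Lipschitz constant of [F]. *)
Lemma lipschitz_extension_Lip : Lip_modulus id F setT = L%:E.
Proof.
have [_ _ FG] := extF; apply/eqP; rewrite eq_le; apply/andP; split.
  apply: supremum_le; first by rewrite lee_fin.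
  move=> _ [x [z [_ _ xz ->]]].
  by rewrite lee_fin ler_pdivrMr ?lipF// normr_gt0 subr_eq0.
rewrite [in leLHS]LE; apply: sup_EFin_le.
  by have [z Ez] := E0; exists `|G z|, z.
move=> _ [z Ez <-]; have := @Lip_modulus_ge0 _ _ _ id F setT (fun t => id).
have : forall v, v != 0 -> ((`|F (z + v) - F z| / `|v|)%:E <= Lip_modulus id F setT)%E.
  move=> v v0; apply: supremum_ge; exists (z + v), z; split=> //.
    by rewrite -subr_eq0 addrAC subrr add0r.
  by rewrite /= addrAC subrr add0r.
case: (Lip_modulus id F setT) => [r H|_ _|_]; [|exact: leey|by rewrite leeNy_eq].
rewrite !lee_fin => r0; apply: dual_le => // v v1.
have [->|v0] := eqVneq v 0; first by rewrite linear0.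
have := H v v0; rewrite lee_fin ler_pdivrMr ?normr_gt0// => Hv.
rewrite -(FG z Ez).2; apply: le_trans (gradient_le_increment _ _) _.
apply: le_trans (ler_norm _) _; apply: le_trans Hv _.
by rewrite ler_piMr.
Qed.

End lipschitz_extension.

(** * Assembly of the four claims from the envelope results *)

Theorem theorem1p2 (R : realType) (alpha : R) (halpha : 0 < alpha <= 1) :
  exists2 Calpha : R, 0 < Calpha &
  forall (X : completeNormedModType R) (C : R) (omega : R -> R)
    (E : set X) (f : X -> R) (G : X -> dual X),
  superreflexive X ->
  0 < C -> norm_power_smooth X alpha C ->
  modulus_of_continuity omega ->
  (forall s t : R, 0 < s -> s <= t ->
    s `^ alpha / omega s <= t `^ alpha / omega t) ->
  E !=set0 ->
  let L := sup [set `|G z| | z in E] in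
  let claims (condition : R -> Prop) :=
    [/\ (* (i) *)
        (exists F : X -> R, C1_convex_extension omega E f G F) <->
        (exists2 M : R, 0 < M & condition M),
        (* (ii) *)
        forall M : R, 0 < M -> condition M ->
        let F := convex_envelope (inf_envelope omega E f G M) in
        [/\ C1_convex_extension omega E f G F,
            (A_co omega F (frechet F) setT <= (Calpha * C * M)%:E)%E &
            (Lip_modulus omega (frechet F) setT
              <= (4 / 3 * Calpha * C * M)%:E)%E] &
        (* (iii) *)
        forall M : R, 0 < M -> condition M -> [bounded G z | z in E] ->
        let F := convex_envelope_Lip L (inf_envelope omega E f G M) in
        [/\ C1_convex_extension omega E f G F,
            (A_co omega F (frechet F) setT <= (Calpha * C * M)%:E)%E,
            (Lip_modulus omega (frechet F) setT
              <= (4 / 3 * Calpha * C * M)%:E)%E,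
            ereal_sup [set `|frechet F x|%:E | x in [set: X]] = L%:E &
            Lip_modulus id F setT = L%:E]] in
  claims (jet_condition omega E f G) /\
  (* (iv) *)
  ((forall s t : R, 0 <= s -> s < t -> omega s < omega t) ->
   omega t @[t --> +oo] --> +oo ->
   claims (jet_conjugate_condition omega E f G)).
Proof.
have [alpha0 alpha1] := andP halpha.
(* The second-difference constant of [phi] of the norm is [16 * C], which plays the part of [K] for
   the envelopes. *)
exists 16 => // X C omega E f G _ C0 smoothX modw powR_modw E0 L claims.
have C16 : 0 <= 16 * C by rewrite mulr_ge0// ltW.
have sd := primitive_norm_second_difference modw alpha0 alpha1 powR_modw C0 smoothX.
have Lip_eq M : 4 / 3 * 16 * C * M = 4 / 3 * (16 * C * M) by rewrite !mulrA.
(* The claims involve [condition] only at positive [M], so one proof serves both the jet condition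
   and its conjugate form. *)
suff claimsP condition :
    (forall M, 0 < M -> condition M <-> jet_condition omega E f G M) ->
    claims condition.
  split=> [|_ _]; apply: claimsP => // M M0.
  exact: jet_conjugate_conditionE.
move=> conditionE.
have jet_continuous z : E z -> continuous (fun x => f z + G z (x - z)).
  by move=> _; exact: continuous_jet.
have ext M : 0 < M -> condition M ->
    C1_convex_extension omega E f G (convex_envelope (inf_envelope omega E f G M)).
  move=> M0 /(conditionE _ M0) jet.
  exact: (envelope_extension modw M0 C16 E0 jet sd jet_continuous
    (@continuous_average _ _)).
split.
- split=> [[F /(C1_convex_extension_jet modw)[M M0 jet]]|[M M0 cM]].
    by exists M => //; apply/conditionE.
  by exists (convex_envelope (inf_envelope omega E f G M)); exact: ext.
- move=> M M0 cM F; split; first exact: ext.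
    move: cM => /(conditionE _ M0) jet.
    exact: (envelope_A_co modw M0 C16 E0 jet sd jet_continuous
      (@continuous_average _ _)).
  move: cM => /(conditionE _ M0) jet; rewrite Lip_eq.
  exact: (envelope_Lip modw M0 C16 E0 jet sd jet_continuous
    (@continuous_average _ _)).
- move=> M M0 /(conditionE _ M0) jet bG F.
  have GL z : E z -> `|G z| <= L.
    move=> Ez; apply: ub_le_sup; last by exists z.
    have [B [_ HB]] := bG; exists (`|B| + 1) => _ [y Ey <-].
    by apply: (HB (`|B| + 1)) => //; rewrite (le_lt_trans (ler_norm B))// ltrDl.
  have L0 : 0 <= L by have [z Ez] := E0; exact: le_trans (GL z Ez).
  (* The affine minorants compete in the Lipschitz envelope because [L] dominates every [|G z|]. *)
  have jet_lipschitz z : E z -> L.-lipschitz (fun x => f z + G z (x - z)).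
    by move=> Ez; apply: lipschitz_jet; exact: GL.
  have extF : C1_convex_extension omega E f G F.
    exact: (envelope_extension modw M0 C16 E0 jet sd jet_lipschitz
      (@lipschitz_average _ _ L)).
  have lipF : forall x y, `|F x - F y| <= L * `|x - y|.
    apply: (envelope_lipschitz E0 jet jet_lipschitz) => u.
    by move=> /lipschitz_setTP.
  split=> //.
  + exact: (envelope_A_co modw M0 C16 E0 jet sd jet_lipschitz
      (@lipschitz_average _ _ L)).
  + rewrite Lip_eq; exact: (envelope_Lip modw M0 C16 E0 jet sd jet_lipschitz
      (@lipschitz_average _ _ L)).
  + exact: (lipschitz_extension_sup_frechet extF E0 _ L0 lipF).
  + exact: (lipschitz_extension_Lip extF E0 _ L0 lipF).
Qed.
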